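(* Assume that polynomials $P_1,\dots,P_N\in\mathbb R[x_1,\dots,x_d]$ have nonzero restrictions to the unit sphere $S^{d-1}\subset\mathbb R^d$ (i.e., none of them vanishes identically on $S^{d-1}$), and that $\delta_1,\dots,\delta_N>0$ are such that \[ \sum_{k=1}^N\delta_k\deg P_k\le\frac1e . \] Then there exists a point $p\in S^{d-1}$ of the maximum of the absolute value of $P_1^{\delta_1}\cdots P_N^{\delta_N}$ on the unit sphere $S^{d-1}$ such that, for every $k=1,\dots,N$, $p$ is at angular distance at least $\delta_k$ from the intersection of the zero set of $P_k$ with $S^{d-1}$.
   Context: The absolute value of $P_1^{\delta_1}\cdots P_N^{\delta_N}$ means the function $|P_1|^{\delta_1}\cdots|P_N|^{\delta_N}$. The angular distance between $x,y\in S^{d-1}$ is $\arccos(x\cdot y)\in[0,\pi]$; the angular distance from a point to a set is the infimum over the points of the set (and the condition is vacuous if the set is empty). $\deg P$ is the degree of the polynomial $P$, and $e$ is the base of natural logarithms.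
   Formalization: The formal theorem assumes d ≥ 2; for d = 1 the claim fails on the two-point sphere (P_1 = x−1, P_2 = x+1 with small δ's: the product vanishes everywhere and each point is a zero of some P_k), and for d = 0 the sphere is empty. *)

(* Defs.v *)
From mathcomp Require Import all_boot all_order all_algebra.
From mathcomp Require Import all_classical all_reals all_analysis.
(* The notations of [mpoly] clash with those of Analysis. *)
From mathcomp Require mpoly.
Import -(notations) mpoly.

Set Implicit Arguments.
Unset Strict Implicit.
Unset Printing Implicit Defensive.

Import Order.TTheory GRing.Theory Num.Theory.

Local Open Scope classical_set_scope.
Local Open Scope ring_scope.

Notation mvpoly R d := (mpoly.mpoly d R).

Section SpherePolynomials.
Context {R : realType} {d : nat}.
Implicit Types (x y : 'rV[R]_d) (A : set 'rV[R]_d) (P : mvpoly R d).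

Definition dotp x y : R := \sum_(i < d) x ord0 i * y ord0 i.

Definition sphere : set 'rV[R]_d := [set x | dotp x x = 1].

Definition peval P x : R := mpoly.meval (fun i => x ord0 i) P.

(* [msize] is one more than the total degree of a nonzero polynomial. *)
Definition pdeg P : nat := (mpoly.msize P).-1.

Definition zero_set P : set 'rV[R]_d := [set x | peval P x = 0].

Definition nonzero_on_sphere P : Prop := exists2 x, sphere x & peval P x != 0.

Definition ang_dist x y : R := acos (dotp x y).

(* The infimum is taken in [\bar R], so the distance to [set0] is [+oo]. *)
Definition ang_dist_set x A : \bar R :=
  ereal_inf [set (ang_dist x y)%:E | y in A].

Definition abs_prod_pow (N : nat) (P : 'I_N -> mvpoly R d) (delta : 'I_N -> R)
  x : R := \prod_(k < N) `|peval (P k) x| `^ delta k.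

Definition is_max_point (f : 'rV[R]_d -> R) A x : Prop :=
  A x /\ forall y, A y -> f y <= f x.

End SpherePolynomials.
Arguments sphere R d : clear implicits.

(* Main.v *)
Require Import Defs.
From mathcomp Require Import all_boot all_order all_algebra.
From mathcomp Require Import all_classical all_reals all_analysis.
From mathcomp Require Import complex ring lra.
From mathcomp Require mpoly separable cyclic cyclotomic.
Import -(notations) mpoly.

Set Implicit Arguments.
Unset Strict Implicit.
Unset Printing Implicit Defensive.

Import Order.TTheory GRing.Theory Num.Theory.
Import numFieldNormedType.Exports.

Local Open Scope classical_set_scope.
Local Open Scope ring_scope.

(** Every maximum point p works. Suppose P_k vanishes at q with
    t = angle(p, q) < delta_k. Take M large, a_j = ceil(M delta_j) and
    Q = prod_j P_j^(a_j). On the great circle through p and q, Q is a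
    trigonometric polynomial of degree D <= M / e + O(1) with a zero of order
    a_k >= M delta_k at q. Its Fourier coefficients are bounded by max |Q|, so
    its a_k-th derivative is at most (2D + 1) D^(a_k) max |Q|, and Taylor's
    formula at q gives
      |Q(p)| <= (2D + 1) max |Q| (D t)^(a_k) / a_k!.
    By a! >= (a / e)^a the factor after max |Q| decays exponentially in M,
    whereas |Q(p)| and max |Q| both equal the M-th power of the maximal value
    up to factors independent of M. The maximal value is positive because, for
    d >= 2, polynomials that are nonzero on the sphere have a common point there
    at which none of them vanishes. *)

(** * Roots of unity and coefficient bounds *)

Lemma closed_prim_root_exists (C : numClosedFieldType) n :
  (0 < n)%N -> {z : C | n.-primitive_root z}.
Proof.
pose p : {poly C} := 'X^n - 1; have [r Dp] := closed_field_poly_normal p.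
move=> n_gt0; apply/sigW; rewrite (monicP _) ?monicXnsubC // scale1r in Dp.
have rn1 : all n.-unity_root r.
  by apply/allP=> z; rewrite -root_prod_XsubC -Dp.
have sz_r : (n < (size r).+1)%N.
  by rewrite -(size_prod_XsubC r id) -Dp size_XnsubC.
(* Among n distinct n-th roots of unity one is primitive; distinctness is the separability of
   ['X^n - 1] in characteristic 0. *)
have [|z] := hasP (cyclic.has_prim_root n_gt0 rn1 _ sz_r); last by exists z.
rewrite -separable.separable_prod_XsubC -Dp cyclotomic.separable_Xn_sub_1 //.
by rewrite pnatr_eq0 -lt0n.
Qed.

Lemma sum_prim_root_exp (C : idomainType) n (z : C) k :
  n.-primitive_root z -> ~~ (n %| k)%N -> \sum_(m < n) z ^+ (k * m) = 0.
Proof.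
move=> zn ndvd; have z1 : z ^+ k - 1 != 0.
  by rewrite subr_eq0 -(expr0 z) (eq_prim_root_expr zn) mod0n.
apply: (mulfI z1); rewrite mulr0.
have := subrX1 (z ^+ k) n; rewrite -exprM mulnC exprM (prim_expr_order zn).
rewrite expr1n subrr => /esym; under eq_bigr do rewrite -exprM.
by [].
Qed.

(** A discrete Cauchy estimate: with n = [size G] and j < n, the j-th coefficient is the mean of
    G(z) z^(-j) over the n-th roots of unity. *)
Lemma norm_coef_le_unit_circle (C : numClosedFieldType) (G : {poly C}) (S : C) :
  (forall z, `|z| = 1 -> `|G.[z]| <= S) -> forall j, `|G`_j| <= S.
Proof.
move=> GS j.
have S0 : 0 <= S by apply: le_trans (GS 1 _); rewrite ?normr_ge0 ?normr1.
have [szj|jsz] := leqP (size G) j; first by rewrite nth_default ?normr0.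
have n0 : (0 < size G)%N by case: (size G) jsz.
set n := size G in jsz n0.
have [z zn] := closed_prim_root_exists C n0.
have z1 : `|z| = 1.
  have /(congr1 Num.norm) := prim_expr_order zn.
  rewrite normrX normr1 => /eqP; rewrite pexpr_eq1 ?normr_ge0 // -?lt0n //.
  by move/eqP.
have dft : \sum_(m < n) G.[z ^+ m] * z ^+ ((n - j) * m) = n%:R * G`_j.
  under eq_bigr => m _.
    rewrite horner_coef mulr_suml; under eq_bigr => i _.
      rewrite -mulrA -exprM [(m * i)%N]mulnC -exprD -mulnDl; over.
    over.
  rewrite exchange_big /= (bigD1 (Ordinal jsz)) //=.
  rewrite [X in _ + X]big1 ?addr0 => [|i ij].
    rewrite -mulr_sumr subnKC ?(ltnW jsz) // mulrC; congr (_ * _).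
    under eq_bigr do rewrite exprM (prim_expr_order zn) expr1n.
    by rewrite sumr_const card_ord.
  rewrite -mulr_sumr (sum_prim_root_exp zn) ?mulr0 //.
  (* [i + (n - j)] lies strictly between 0 and 2n, so n divides it only if i = j. *)
  apply/negP => /dvdnP [q Dq]; move/negP: ij; apply; apply/eqP/val_inj => /=.
  have ltin : (i < n)%N by exact: ltn_ord.
  have nj : (i + (n - j) < 2 * n)%N.
    by rewrite mul2n -addnn -addSn leq_add ?leq_subr.
  have nj0 : (0 < i + (n - j))%N by rewrite addn_gt0 subn_gt0 jsz orbT.
  have q1 : q = 1%N.
    apply/eqP; rewrite eqn_leq; apply/andP; split.
      by move: nj; rewrite Dq ltn_pmul2r.
    by move: nj0; rewrite Dq muln_gt0 => /andP[].
  move: Dq; rewrite q1 mul1n => Dq.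
  by apply/eqP; rewrite -(eqn_add2r (n - j)) Dq subnKC // ltnW.
have nz : 0 < n%:R :> C by rewrite ltr0n.
rewrite -(ler_pM2l nz) -[X in X * `|_| <= _](ger0_norm (ltW nz)) -normrM -dft.
apply: le_trans (ler_norm_sum _ _ _) _.
have -> : n%:R * S = \sum_(m < n) S by rewrite sumr_const card_ord mulr_natl.
apply: ler_sum => m _; rewrite normrM !normrX z1 expr1n mulr1.
by apply: GS; rewrite normrX z1 expr1n.
Qed.

(** Induction on a: applied to the shifted family, the bound for [h 1] says that the difference [g]
    of the two sides has a nonnegative derivative, and [g] vanishes at 0. *)
Lemma le_taylor_of_vanishing (R : realType) (a : nat) (B : R) (h : nat -> R -> R) :
  (forall i (t : R), is_derive t (1 : R) (h i) (h i.+1 t)) ->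
  (forall i, (i < a)%N -> h i 0 = 0) ->
  (forall t, h a t <= B) ->
  forall t, 0 <= t -> h 0%N t <= B * t ^+ a / a`!%:R.
Proof.
elim: a h => [|a IH] h dh h0 hB t t0.
  by rewrite expr0 mulr1 fact0 divr1.
pose g s : R := (B / a.+1`!%:R) * s ^+ a.+1 - h 0%N s.
pose g' s : R := B * s ^+ a / a`!%:R - h 1%N s.
have g'0 s : 0 <= s -> 0 <= g' s.
  move=> s0; rewrite subr_ge0; apply: (IH (fun i => h i.+1)) => // i ia.
  exact: h0.
have dg (s : R) : is_derive s (1 : R) g (g' s).
  have -> : g = (B / a.+1`!%:R) *: (@id R ^+ a.+1) - h 0%N.
    by apply/funext => x; rewrite !fctE.
  apply: is_derive_eq.
  rewrite /g' /GRing.scale /= mulr1 factS natrM.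
  have : a`!%:R != 0 :> R by rewrite pnatr_eq0 -lt0n fact_gt0.
  have : a.+1%:R != 0 :> R by rewrite pnatr_eq0.
  by move=> ? ?; field; apply/andP.
have [|c] := MVT_segment t0 (fun x _ => dg x).
  apply: continuous_subspaceT => s; apply: differentiable_continuous.
  by apply/derivable1_diffP; have [] := dg s.
rewrite in_itv /= => /andP[c0 _].
rewrite subr0 {1 2}/g expr0n /= mulr0 h0 // !subr0.
move=> gt; have : 0 <= g' c * t by rewrite mulr_ge0 ?g'0.
by rewrite -gt subr_ge0 mulrAC.
Qed.

(** * Trigonometric polynomials with a zero of high order *)

Section UnitCircle.
Context {R : realType}.
Local Open Scope complex_scope.

Definition cexp (t : R) : R[i] := cos t +i* sin t.

Lemma cexpD s t : cexp (s + t) = cexp s * cexp t.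
Proof. by rewrite /cexp cosD sinD; simpc; congr (_ +i* _); rewrite addrC. Qed.

Lemma cexp0 : cexp 0 = 1.
Proof. by rewrite /cexp cos0 sin0. Qed.

Lemma cexpN t : cexp (- t) = (cexp t)^*.
Proof. by rewrite /cexp cosN sinN. Qed.

Lemma cexpMn n t : cexp (n%:R * t) = cexp t ^+ n.
Proof.
elim: n => [|n IH]; first by rewrite mul0r cexp0 expr0.
by rewrite -natr1 mulrDl mul1r cexpD IH exprSr.
Qed.

Lemma norm_cexp t : `|cexp t| = 1.
Proof. by rewrite normc_def /= cos2Dsin2 sqrtr1. Qed.

Lemma is_derive_Re_cexp (c : R[i]) (k t : R) :
  is_derive t (1 : R) (fun t => complex.Re (c * cexp (k * t)))
    (complex.Re (c * ('i * k%:C) * cexp (k * t))).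
Proof.
case: c => a b; rewrite /cexp /=.
apply: is_derive_eq; rewrite /GRing.scale /=; ring.
Qed.

End UnitCircle.

(** Up to powers of the imaginary unit, these moments are the derivatives at s = 0 of the sum of G_j
    exp(i(j - c)s), which inherits from G a zero of order a. The operator z d/dz - c stands in for
    differentiation in s. *)
Lemma sum_moment_eq0 (F : fieldType) (c : F) (a n i : nat) (G : {poly F}) :
  (size G <= n)%N -> (i < a)%N -> ('X - 1%:P) ^+ a %| G ->
  \sum_(j < n) G`_j * (j%:R - c) ^+ i = 0.
Proof.
elim: i a G => [|i IH] [//|a] G szG ia dvdG.
  have /eqP : root G 1.
    by rewrite -dvdp_XsubCl; apply: dvdp_trans dvdG; rewrite exprS dvdp_mulr.
  rewrite (horner_coef_wide _ szG) => G1; rewrite -[RHS]G1; apply: eq_bigr => j _.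
  by rewrite expr0 expr1n.
(* [L] multiplies the j-th coefficient by [j - c] and lowers the order of
   vanishing at 1 by at most one. *)
pose L := 'X * G^`() - c *: G.
have coefL j : L`_j = G`_j * (j%:R - c).
  rewrite /L coefB coefXM coefZ coef_deriv mulrBr mulr_natr [c * _]mulrC.
  by case: j => [|j] //=; rewrite mulr0n.
under eq_bigr do rewrite exprS mulrA -coefL.
apply: (IH a) => //.
  apply/leq_sizeP => j nj; rewrite coefL nth_default ?mul0r //.
  exact: leq_trans nj.
case/dvdpP: dvdG => H DG; rewrite /L DG derivM deriv_exp derivXsubC mul1r exprS.
move: ('X - 1%:P) => Y.
apply/dvdpP; exists ('X * (H^`() * Y + H *+ a.+1) - c *: (H * Y)).
by rewrite mulrBl -scalerAl -!mulrA mulrDl -mulrA mulrnAl mulrnAr.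
Qed.

Section CircleBound.
Context {R : realType}.
Local Open Scope complex_scope.

(** The factor conj(z)^D centres the exponents: the frequencies j - D are at most D in absolute
    value, not 2D. This yields D^a in the bound, and eventually the constant 1/e rather than
    1/(2e). *)
Lemma Re_circle_le (D a : nat) (G : {poly R[i]}) (S t : R) :
  (size G <= D.*2.+1)%N -> ('X - 1%:P) ^+ a %| G ->
  (forall z, `|z| = 1 -> `|G.[z]| <= S%:C) -> 0 <= t ->
  complex.Re (conjc (cexp t) ^+ D * G.[cexp t])
    <= D.*2.+1%:R * S * (D%:R * t) ^+ a / a`!%:R.
Proof.
move=> szG dvdG GS t0.
pose k (j : 'I_D.*2.+1) : R := j%:R - D%:R.
have kD j : `|k j| <= D%:R.
  rewrite ler_norml lerBrDl subrr ler0n /= lerBlDr -natrD ler_nat addnn.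
  by rewrite -ltnS.
(* [h m] is the m-th derivative in s of the real part to be bounded; at 0 it reduces to a moment of
   G about D. *)
pose h m (s : R) : R := \sum_(j < D.*2.+1) complex.Re
  (G`_j * ('i * (k j)%:C) ^+ m * cexp (k j * s)).
have dh m (s : R) : is_derive s (1 : R) (h m) (h m.+1 s).
  have -> : h m = \sum_(j < D.*2.+1) (fun s : R => complex.Re
      (G`_j * ('i * (k j)%:C) ^+ m * cexp (k j * s))).
    by apply/funext => x; rewrite fct_sumE.
  rewrite /h; apply: is_derive_sum => j; rewrite exprSr [X in complex.Re (X * _)]mulrA.
  exact: is_derive_Re_cexp.
have h0 m : (m < a)%N -> h m 0 = 0.
  move=> ma; rewrite /h -raddf_sum /=.
  under eq_bigr do rewrite mulr0 cexp0 mulr1 exprMn mulrCA.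
  rewrite -mulr_sumr.
  under eq_bigr do rewrite /k rmorphB /= !rmorph_nat.
  by rewrite (sum_moment_eq0 _ szG ma dvdG) mulr0.
have hB s : h a s <= D.*2.+1%:R * S * D%:R ^+ a.
  have -> : D.*2.+1%:R * S * D%:R ^+ a = \sum_(j < D.*2.+1) S * D%:R ^+ a.
    by rewrite sumr_const card_ord -[RHS]mulr_natl mulrA.
  rewrite /h; apply: ler_sum => j _; apply: le_trans (ler_norm _) _.
  rewrite -lecR; apply: le_trans (normc_ge_Re _) _.
  rewrite !normrM norm_cexp mulr1 normrX normrM rmorphM rmorphXn /=.
  apply: ler_pM; rewrite ?exprn_ge0 ?mulr_ge0 ?normr_ge0 //.
    exact: norm_coef_le_unit_circle.
  rewrite lerXn2r ?nnegrE ?mulr_ge0 ?normr_ge0 ?ler0c ?ler0n //.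
  by rewrite !normc_def /= expr0n expr1n add0r sqrtr1 mul1r addr0 lecR sqrtr_sqr.
have -> : complex.Re (conjc (cexp t) ^+ D * G.[cexp t]) = h 0%N t.
  rewrite (horner_coef_wide _ szG) mulr_sumr raddf_sum /h; apply: eq_bigr => j _.
  rewrite expr0 mulr1 -cexpN -cexpMn mulrCA -cexpMn -cexpD.
  by congr (complex.Re (_ * cexp _)); rewrite /k; ring.
by rewrite exprMn mulrA; exact: (le_taylor_of_vanishing dh).
Qed.

End CircleBound.

(** * Degree bounds in the form [size p <= n.+1], which admits p = 0 *)

Lemma size_mul_leS (K : nzRingType) (p q : {poly K}) m n :
  (size p <= m.+1)%N -> (size q <= n.+1)%N -> (size (p * q)%R <= (m + n).+1)%N.
Proof.
move=> pm qn; apply: leq_trans (size_polyMleq _ _) _.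
by rewrite -subn1 leq_subLR add1n -addnS -addSn leq_add.
Qed.

Lemma size_prod_leS (K : comNzRingType) (I : Type) (r : seq I)
    (F : I -> {poly K}) (n : I -> nat) :
  (forall i, (size (F i) <= (n i).+1)%N) ->
  (size (\prod_(i <- r) F i)%R <= (\sum_(i <- r) n i).+1)%N.
Proof.
move=> Fn; apply: (big_ind2 (fun (p : {poly K}) m => (size p <= m.+1)%N)) => //.
  by rewrite size_poly1.
by move=> p m q k; apply: size_mul_leS.
Qed.

Lemma size_exp_leS (K : comNzRingType) (p : {poly K}) n a :
  (size p <= n.+1)%N -> (size (p ^+ a)%R <= (n * a).+1)%N.
Proof.
move=> pn; have := size_prod_leS (index_enum 'I_a) (fun=> pn).
by rewrite prodr_const sum_nat_const card_ord mulnC.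
Qed.

(** * Restriction of polynomials to great circles *)

Section GreatCircle.
Context {R : realType} {d : nat}.
Implicit Types (x y p q : 'rV[R]_d) (P : mvpoly R d).
Local Open Scope complex_scope.

(** The parameter is a complex number instead of an angle, so that restrictions become polynomials
    in z and its conjugate. *)
Definition great_circle x y (z : R[i]) : 'rV[R]_d :=
  complex.Re z *: x + complex.Im z *: y.

Lemma conjcM_unit (z : R[i]) : `|z| = 1 -> conjc z * z = 1.
Proof. by move=> z1; rewrite mulrC -sqr_normc z1 expr1n. Qed.

(* On the unit circle [conjc z] is the inverse of [z], so this says that P
   restricts to a trigonometric polynomial of degree at most [pdeg P]. *)
Lemma great_circle_poly P x y : exists2 G : {poly R[i]},
  (size G <= (pdeg P).*2.+1)%N &
  forall z, `|z| = 1 ->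
    (peval P (great_circle x y z))%:C = conjc z ^+ pdeg P * G.[z].
Proof.
set n := pdeg P.
(* For |z| = 1 the i-th coordinate x_i Re z + y_i Im z equals a_i z + b_i conj(z), which is conj(z)
   (a_i z^2 + b_i). *)
pose a i : R[i] := (x ord0 i / 2%:R) +i* (- (y ord0 i / 2%:R)).
pose b i : R[i] := (x ord0 i / 2%:R) +i* (y ord0 i / 2%:R).
pose l i : {poly R[i]} := a i *: 'X^2 + (b i)%:P.
have mn (m : mpoly.multinom d) : m \in mpoly.msupp P -> (mpoly.mdeg m <= n)%N.
  by move=> /mpoly.msize_mdeg_lt; rewrite /n /pdeg; case: mpoly.mmeasure.
(* The power of ['X] pads monomials of lower degree, so that conj(z)^n factors out of all of
   them. *)
pose F (m : mpoly.multinom d) : {poly R[i]} := 'X^(n - mpoly.mdeg m) *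
  \prod_i l i ^+ (mpoly.fun_of_multinom m i).
exists (\sum_(m <- mpoly.msupp P) (mpoly.mcoeff m P)%:C *: F m).
  apply: leq_trans (size_sum _ _ _) _; apply/bigmax_leqP_seq => m mP _.
  apply: leq_trans (size_scale_leq _ _) _.
  have -> : n.*2 = ((n - mpoly.mdeg m) + (mpoly.mdeg m + n))%N.
    by rewrite addnA subnK ?mn // addnn.
  apply: size_mul_leS; first by rewrite size_polyXn.
  apply: (@leq_trans (mpoly.mdeg m).*2.+1).
    rewrite mpoly.mdegE -addnn -big_split /=; apply: size_prod_leS => i.
    rewrite addnn -mul2n; apply: size_exp_leS.
    apply: leq_trans (size_polyD _ _) _; rewrite geq_max; apply/andP; split.
      by apply: leq_trans (size_scale_leq _ _) _; rewrite size_polyXn.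
    by apply: leq_trans (size_polyC_leq1 _) _.
  by rewrite ltnS -addnn leq_add2l mn.
move=> z z1; rewrite /peval mpoly.mevalE rmorph_sum horner_sum mulr_sumr.
have lz i : conjc z * (l i).[z] = (great_circle x y z ord0 i)%:C.
  rewrite /l hornerD hornerZ hornerXn hornerC mulrDr mulrCA expr2.
  rewrite [conjc z * (z * z)]mulrA conjcM_unit // mul1r.
  case: z {z1} => u v; rewrite /a /b /great_circle !mxE /=; simpc.
  by congr (_ +i* _); field.
apply: eq_big_seq => m mP; rewrite hornerZ hornerM mulrCA rmorphM; congr (_ * _).
rewrite hornerXn horner_prod rmorph_prod mulrA.
rewrite -[X in conjc z ^+ X](subnK (mn _ mP)) exprD.
rewrite [X in _ = X * _]mulrAC -exprMn conjcM_unit //.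
rewrite expr1n mul1r mpoly.mdegE expr_sum -big_split /=; apply: eq_bigr => i _.
by rewrite horner_exp -exprMn lz rmorphXn.
Qed.
End GreatCircle.

(** * Great circles through two points of the sphere *)

Section SphereGeometry.
Context {R : realType} {d : nat}.
Implicit Types (x y p q v : 'rV[R]_d) (P Q : mvpoly R d).
Local Open Scope complex_scope.

Lemma dotpC x y : dotp x y = dotp y x.
Proof. by apply: eq_bigr => i _; rewrite mulrC. Qed.

Lemma dotpDl x y v : dotp (x + y) v = dotp x v + dotp y v.
Proof. by rewrite -big_split; apply: eq_bigr => i _; rewrite mxE mulrDl. Qed.

Lemma dotpZl (a : R) x y : dotp (a *: x) y = a * dotp x y.
Proof. by rewrite mulr_sumr; apply: eq_bigr => i _; rewrite mxE mulrA. Qed.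

Lemma dotpDr x y v : dotp v (x + y) = dotp v x + dotp v y.
Proof. by rewrite dotpC dotpDl !(dotpC v). Qed.

Lemma dotpZr (a : R) x y : dotp y (a *: x) = a * dotp y x.
Proof. by rewrite dotpC dotpZl (dotpC x). Qed.

Lemma dotp_ge0 x : 0 <= dotp x x.
Proof. by apply: sumr_ge0 => i _; rewrite -expr2 sqr_ge0. Qed.

Lemma dotp_eq0 x : dotp x x = 0 -> x = 0.
Proof.
move=> /eqP; rewrite psumr_eq0 => [/allP x0|i _]; last by rewrite -expr2 sqr_ge0.
apply/rowP => i; rewrite mxE; apply/eqP.
by have := x0 i (mem_index_enum _); rewrite mulf_eq0 orbb.
Qed.

(** This Pythagorean identity gives Cauchy-Schwarz on the sphere and makes the sine of the angle the
    length of the part of p orthogonal to q. *)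
Lemma dotp_residual p q : dotp p p = 1 -> dotp q q = 1 ->
  dotp (p - dotp p q *: q) (p - dotp p q *: q) = 1 - dotp p q ^+ 2.
Proof.
move=> pp qq; rewrite -scaleNr !(dotpDl, dotpDr, dotpZl, dotpZr) pp qq (dotpC q).
by ring.
Qed.

Lemma dotp_itv p q : sphere R d p -> sphere R d q -> -1 <= dotp p q <= 1.
Proof.
move=> pp qq; have := dotp_ge0 (p - dotp p q *: q).
rewrite dotp_residual // => c1; apply/andP; split; nra.
Qed.

Lemma unit_normalize v : v != 0 -> exists c : R, dotp (c *: v) (c *: v) = 1.
Proof.
move=> v0; have vv : 0 < dotp v v.
  rewrite lt_neqAle dotp_ge0 andbT eq_sym; apply/eqP => /dotp_eq0 /eqP.
  exact/negP.
exists (Num.sqrt (dotp v v))^-1.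
rewrite dotpZl dotpZr mulrA -expr2 exprVn sqr_sqrtr ?(ltW vv) // mulVf //.
exact: lt0r_neq0.
Qed.

Lemma exists_orthogonal_unit q : (2 <= d)%N ->
  exists2 v, dotp v v = 1 & dotp q v = 0.
Proof.
move=> hd; pose i0 : 'I_d := Ordinal (ltnW hd); pose i1 : 'I_d := Ordinal hd.
have i10 : i1 != i0 by [].
suff [w w0 qw] : exists2 w, w != 0 & dotp q w = 0.
  have [c cw] := unit_normalize w0; exists (c *: w) => //.
  by rewrite dotpZr qw mulr0.
have dotpE i (a : R) : dotp q (a *: delta_mx ord0 i) = a * q ord0 i.
  rewrite dotpZr /dotp (bigD1 i) //= big1 ?addr0 => [|j ji].
    by rewrite mxE !eqxx mulr1.
  by rewrite mxE (negbTE ji) andbF mulr0.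
have [q0|q0] := eqVneq (q ord0 i0) 0.
  exists (1 *: delta_mx ord0 i0); last by rewrite dotpE q0 mulr0.
  apply/eqP => /rowP /(_ i0); rewrite !mxE !eqxx mulr1 => /eqP.
  by rewrite oner_eq0.
exists (- q ord0 i1 *: delta_mx ord0 i0 + q ord0 i0 *: delta_mx ord0 i1).
  apply/eqP => /rowP /(_ i1); rewrite !mxE !eqxx (negbTE i10) /= mulr0 add0r.
  by rewrite mulr1; exact/eqP.
by rewrite dotpDr !dotpE; ring.
Qed.

(** Normalizing the part of p orthogonal to q gives v. If that part is zero, p and q are equal or
    antipodal and any unit vector orthogonal to q will do. *)
Lemma exists_great_circle p q : (2 <= d)%N -> sphere R d p -> sphere R d q ->
  exists v, [/\ dotp v v = 1, dotp q v = 0 &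
    p = great_circle q v (dotp p q +i* Num.sqrt (1 - dotp p q ^+ 2))].
Proof.
move=> hd pp qq; rewrite /great_circle /=; set c := dotp p q.
have Dw := dotp_residual pp qq; rewrite -/c in Dw.
set w := p - c *: q in Dw.
have qw : dotp q w = 0.
  by rewrite /w -scaleNr dotpDr dotpZr qq dotpC -/c; ring.
have [w0|w0] := eqVneq w 0.
  have [v vv qv] := exists_orthogonal_unit q hd; exists v; split => //.
  rewrite -Dw w0 /dotp big1 => [|i _]; last by rewrite mxE mul0r.
  by rewrite sqrtr0 scale0r addr0; apply/eqP; rewrite -subr_eq0 -/w w0.
set s := Num.sqrt _.
have s0 : s != 0.
  rewrite sqrtr_eq0 -ltNge -Dw lt_neqAle dotp_ge0 andbT eq_sym.
  by apply: contra w0 => /eqP /dotp_eq0 ->.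
have s2 : s * s = dotp w w by rewrite -expr2 sqr_sqrtr -Dw // dotp_ge0.
exists (s^-1 *: w); split.
- by rewrite dotpZl dotpZr -s2; field.
- by rewrite dotpZr qw mulr0.
- by rewrite scalerA divff // scale1r /w addrC subrK.
Qed.

Lemma great_circle_sphere x y z : dotp x x = 1 -> dotp y y = 1 ->
  dotp x y = 0 -> `|z| = 1 -> sphere R d (great_circle x y z).
Proof.
move=> xx yy xy z1; rewrite /sphere /great_circle /=.
rewrite !(dotpDl, dotpDr, dotpZl, dotpZr) xx yy (dotpC y) xy.
have /(congr1 (@complex.Re R)) := add_Re2_Im2 z.
rewrite z1 expr1n /= => uv; rewrite -[RHS]uv.
by ring.
Qed.

(** A great circle joins a point where P is nonzero to one where Q is; the restrictions are nonzero
    polynomials in z, hence so is their product. *)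
Lemma nonzero_on_sphereM P Q : (2 <= d)%N ->
  nonzero_on_sphere P -> nonzero_on_sphere Q -> nonzero_on_sphere (P * Q).
Proof.
move=> hd [x sx Px] [y sy Qy].
have [v [vv xv Dy]] := exists_great_circle hd sy sx.
have [F _ PF] := great_circle_poly P x v.
have [G _ QG] := great_circle_poly Q x v.
set w := _ +i* _ in Dy.
have w1 : `|w| = 1.
  rewrite normc_def /= sqr_sqrtr ?subrKC ?sqrtr1 // subr_ge0.
  by have := dotp_ge0 (y - dotp y x *: x); rewrite dotp_residual // subr_ge0.
have F0 : F != 0.
  apply: contra_neq Px => F0; have := PF 1 (normr1 _).
  rewrite F0 horner0 mulr0 /great_circle /= scale1r scale0r addr0.
  by case.
have G0 : G != 0.
  by apply: contra_neq Qy => G0; have := QG w w1; rewrite G0 horner0 mulr0 -Dy; case.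
(* The coefficient bound with S = 0: a polynomial that vanishes on the unit circle is zero. *)
have [z z1 FGz] : exists2 z, `|z| = 1 & (F * G).[z] != 0.
  apply: contrapT => noz; have /eqP := mulf_neq0 F0 G0; apply.
  apply/polyP => j; rewrite coef0; apply/eqP; rewrite -normr_le0.
  apply: norm_coef_le_unit_circle => z z1; rewrite normr_le0.
  by apply: contrapT => /negP FGz; apply: noz; exists z.
exists (great_circle x v z); first exact: great_circle_sphere.
have zJ : conjc z != 0.
  by rewrite conjc_eq0 -normr_eq0 z1 oner_eq0.
move: FGz; rewrite hornerM mulf_eq0 negb_or => /andP[Fz Gz].
rewrite /peval mpoly.mevalM mulf_neq0 //.
  by rewrite -(inj_eq (@complexI R)) [X in X != _]PF // mulf_neq0 // expf_neq0.
by rewrite -(inj_eq (@complexI R)) [X in X != _]QG // mulf_neq0 // expf_neq0.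
Qed.

End SphereGeometry.

(** * Continuity and existence of maximum points *)

Section SphereMaximum.
Context {R : realType} {d : nat}.
Implicit Types (x y p q : 'rV[R]_d) (P : mvpoly R d).

Lemma continuous_peval P : continuous (peval P).
Proof.
have -> : peval P = fun x =>
    \sum_(m <- msupp P) mcoeff m P * \prod_i x ord0 i ^+ fun_of_multinom m i.
  by apply/funext => x; rewrite /peval mevalE.
have ctM (m : multinom d) :
    continuous (fun x : 'rV[R]_d => \prod_i x ord0 i ^+ fun_of_multinom m i).
  apply: continuous_big => [|i _ x]; first exact: mul_continuous.
  apply: (@cvg_comp _ _ _ (fun x : 'rV[R]_d => x ord0 i) (fun z => z ^+ _)).
    exact: coord_continuous.
  exact: exprn_continuous.
apply: continuous_big => [|m _ x]; first exact: add_continuous.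
by apply: (@cvgMl_tmp _ _ (nbhs x)); exact: ctM.
Qed.

Lemma continuous_norm_powR (a : R) : 0 < a -> continuous (fun y : R => `|y| `^ a).
Proof.
move=> a0 y; have [->|y0] := eqVneq y 0; last first.
  apply: (@cvg_comp _ _ _ Num.norm (fun z => z `^ a) _ (nbhs `|y|)).
    exact: norm_continuous.
  suff : {for `|y|, continuous (fun z : R => z `^ a)} by [].
  apply: differentiable_continuous; apply/derivable1_diffP/derivable_powR.
  by rewrite in_itv /= normr_gt0 y0.
(* At 0 continuity is checked directly, with radius e^(1/a). *)
apply/cvgrPdist_lt => e e0.
have e1 : 0 < e `^ a^-1 by exact: powR_gt0.
near=> z; rewrite normr0 powR0 ?gt_eqF // sub0r normrN ger0_norm ?powR_ge0 //.
have -> : e = (e `^ a^-1) `^ a by rewrite -powRrM mulVf ?gt_eqF // powRr1 // ltW.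
rewrite gt0_ltr_powR ?nnegrE ?normr_ge0 ?powR_ge0 //.
Unshelve. all: by end_near. Qed.

Lemma compact_sphere : compact (sphere R d).
Proof.
apply: (@subclosed_compact _ _
  [set v : 'rV[R]_d | forall i, `[-1, 1]%classic (v ord0 i)]).
- have -> : sphere R d = (fun x => dotp x x) @^-1` [set 1] by [].
  apply: closed_comp => [x H|]; last exact: closed_eq.
  move: x {H}; apply: continuous_big => [|i _ x]; first exact: add_continuous.
  by apply: (@cvgM _ _ (nbhs x)); exact: coord_continuous.
- by have := @rV_compact R d (fun=> `[-1, 1]%classic)
    (fun=> @segment_compact R _ _).
- move=> x /= xx i; rewrite in_itv /=.
  have : x ord0 i * x ord0 i <= 1.
    rewrite -xx /dotp (bigD1 i) //= lerDl sumr_ge0 // => j _.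
    by rewrite -expr2 sqr_ge0.
  by move=> ?; apply/andP; split; nra.
Qed.

Lemma exists_max_on_sphere (f : 'rV[R]_d -> R) :
  (0 < d)%N -> continuous f -> exists p, is_max_point f (sphere R d) p.
Proof.
move=> d0 cf.
have sph0 : sphere R d !=set0.
  exists (delta_mx ord0 (Ordinal d0)).
  rewrite /sphere /= /dotp (bigD1 (Ordinal d0)) //= big1 ?addr0 => [|j jd].
    by rewrite mxE !eqxx mulr1.
  by rewrite mxE (negbTE jd) andbF mulr0.
have [p] := EVT_max_rV sph0 compact_sphere (continuous_subspaceT cf).
by rewrite inE => sp pmax; exists p; split=> // y sy; apply: pmax; rewrite inE.
Qed.

Lemma continuous_abs_prod_pow N (P : 'I_N -> mvpoly R d) (delta : 'I_N -> R) :
  (forall k, 0 < delta k) -> continuous (abs_prod_pow P delta).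
Proof.
move=> delta0; apply: continuous_big => [|k _]; first exact: mul_continuous.
move=> x; apply: (@cvg_comp _ _ _ (peval (P k)) (fun z => `|z| `^ delta k)).
  exact: continuous_peval.
exact: continuous_norm_powR.
Qed.

Lemma peval_bounded_on_sphere P : (0 < d)%N ->
  exists B : R, forall x, sphere R d x -> `|peval P x| <= B.
Proof.
move=> d0; have [|p [_ pmax]] := @exists_max_on_sphere (fun x => `|peval P x|) d0.
  move=> x; apply: (@cvg_comp _ _ _ (peval P) Num.norm).
    exact: continuous_peval.
  exact: norm_continuous.
by exists `|peval P p|.
Qed.

End SphereMaximum.

(** * Numerical estimates *)

Section Numeric.
Context {R : realType}.

(** Rounding the exponent s up to an integer a multiplies by u^(a - s) with a - s in [0, 1]; the
    factor allowed for this does not depend on s. *)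
Lemma exprn_le_powR_max (u s : R) (a : nat) : 0 <= u -> 0 < s ->
  s <= a%:R <= s + 1 -> u ^+ a <= u `^ s * Num.max 1 u.
Proof.
move=> u0 s0 /andP[sa as1].
have a0 : a%:R != 0 :> R by rewrite gt_eqF // (lt_le_trans s0).
rewrite -powR_mulrn //.
have [->|u1] := eqVneq u 0; first by rewrite !powR0 ?mul0r // gt_eqF.
have {u1}u0' : 0 < u by rewrite lt_neqAle eq_sym u1.
rewrite -(subrKC s a%:R) powRD ?(negbTE (lt0r_neq0 u0')) ?implybT //.
rewrite ler_wpM2l ?powR_ge0 //; have [u1|u1] := leP u 1.
  by rewrite -[leRHS](powRr0 u) ger_powR ?u0' // subr_ge0.
by rewrite ler1_powR ?(ltW u1) // lerBlDl.
Qed.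

Lemma powR_min_le_exprn (u s : R) (a : nat) : 0 <= u -> 0 < s ->
  s <= a%:R <= s + 1 -> u `^ s * Num.min 1 u <= u ^+ a.
Proof.
move=> u0 s0 /andP[sa as1].
rewrite -powR_mulrn //.
have [->|u1] := eqVneq u 0; first by rewrite powR0 ?mul0r ?powR_ge0 // gt_eqF.
have {u1}u0' : 0 < u by rewrite lt_neqAle eq_sym u1.
rewrite -(subrKC s a%:R) powRD ?(negbTE (lt0r_neq0 u0')) ?implybT //.
rewrite ler_wpM2l ?powR_ge0 //; have [u1|u1] := leP 1 u.
  by rewrite -[leLHS](powRr0 u) ler_powR // subr_ge0.
by rewrite ger1_powR ?u0' ?(ltW u1) // lerBlDl.
Qed.

Lemma exprn_fact_le_expR (x : R) n : 0 <= x -> x ^+ n / n`!%:R <= expR x.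
Proof.
move=> x0; case: n => [|n]; first by rewrite expr0 fact0 divr1 -expR0 ler_expR.
by apply: le_trans (expR_ge1Dxn n x0); rewrite lerDr.
Qed.

(* The factor [expR 1] enters through [a! >= (a / e) ^ a]. *)
Lemma taylor_term_le_expR (x s : R) (a : nat) : 0 <= x ->
  x * expR 1 <= (1 - s) * a%:R -> x ^+ a / a`!%:R <= expR (- (s * a%:R)).
Proof.
move=> x0 xs; have a0 : 0 < a`!%:R :> R by rewrite ltr0n fact_gt0.
have [->|an0] := posnP a; first by rewrite expr0 fact0 divr1 mulr0 oppr0 expR0.
have s1 : 0 <= 1 - s.
  rewrite -(pmulr_lge0 _ (_ : 0 < a%:R)) ?ltr0n //.
  by apply: le_trans xs; rewrite mulr_ge0 ?expR_ge0.
rewrite -(ler_pM2r (expR_gt0 a%:R)).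
rewrite mulrAC -[X in expR X](mulr1 a%:R) expRM_natl -exprMn.
apply: (@le_trans _ _ (((1 - s) * a%:R) ^+ a / a`!%:R)).
  rewrite ler_pM2r ?invr_gt0 // lerXn2r ?nnegrE ?mulr_ge0 ?expR_ge0 //.
(* Two bounds are multiplied: (1 - s)^a <= exp(-sa) from 1 - s <= exp(-s), and a^a / a! <= exp(a)
   from the exponential series. *)
rewrite exprMn -mulrA; apply: ler_pM; rewrite ?exprn_ge0 ?divr_ge0 ?ler0n //.
  rewrite mulrC -mulrN expRM_natl lerXn2r ?nnegrE ?expR_ge0 //.
  exact: (expR_ge1Dx (- s)).
by rewrite -expRM_natl mulr1; exact: exprn_fact_le_expR.
Qed.

(** By exp(y) >= 1 + y^2 / 2 at y = cM, any M > 2K / c^2 works. *)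
Lemma linear_expRN_lt1 (c K : R) : 0 < c ->
  exists M0 : nat, forall M : nat, (M0 <= M)%N ->
    K * M%:R * expR (- (c * M%:R)) < 1.
Proof.
move=> c0; set B := 2 * K / c ^+ 2; exists (Num.bound B).+1 => M hM.
have c2 : 0 < c ^+ 2 by rewrite exprn_gt0.
have M0 : 0 < M%:R :> R by rewrite ltr0n; case: M hM.
have MK : 2 * K / c ^+ 2 < M%:R.
  apply: le_lt_trans (ler_norm _) _; rewrite -/B.
  apply: lt_le_trans (archi_boundP (normr_ge0 _)) _.
  by rewrite /Num.bound normr_id ler_nat ltnW.
rewrite expRN ltr_pdivrMr ?expR_gt0 // mul1r.
have := @expR_ge1Dxn _ (c * M%:R) 1 (mulr_ge0 (ltW c0) (ltW M0)).
apply: lt_le_trans; move: MK; rewrite ltr_pdivrMr // => MK.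
rewrite (_ : 2`! = 2)%N // exprMn; nra.
Qed.
End Numeric.

Lemma norm_Re_circle_le (R : realType) (D a : nat) (G : {poly R[i]}) (S t : R) :
  (size G <= D.*2.+1)%N -> ('X - 1%:P) ^+ a %| G ->
  (forall z, `|z| = 1 -> `|G.[z]| <= (S%:C)%C) -> 0 <= t ->
  `|complex.Re (conjc (cexp t) ^+ D * G.[cexp t])|
    <= D.*2.+1%:R * S * (D%:R * t) ^+ a / a`!%:R.
Proof.
move=> szG dvdG GS t0; rewrite ler_norml lerNl -raddfN -mulrN -hornerN /=.
by rewrite !Re_circle_le ?size_polyN ?dvdpNr // => z /GS; rewrite hornerN normrN.
Qed.

(** * Positivity of the maximum and the bound near a zero *)

Section MaximumPoint.
Context {R : realType} {d N : nat}.
Context (P : 'I_N -> mvpoly R d) (delta : 'I_N -> R).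
Implicit Types (p q x : 'rV[R]_d).

Lemma sphere_point_nonzero_all : (2 <= d)%N ->
  (forall k, nonzero_on_sphere (P k)) ->
  exists2 x, sphere R d x & forall k, peval (P k) x != 0.
Proof.
move=> hd hP; have [x sx Px] : nonzero_on_sphere (\prod_(k < N) P k).
  apply: big_ind => // [|F G]; last exact: nonzero_on_sphereM.
  (* The empty product is 1, so only a point of the sphere is needed: a unit vector orthogonal to
     0. *)
  have [v vv _] := exists_orthogonal_unit (0 : 'rV[R]_d) hd.
  by exists v => //; rewrite /peval rmorph1 oner_eq0.
exists x => // k; apply: contra_neq Px => Pk.
by rewrite /peval rmorph_prod (bigD1 k) //= -/(peval _ _) Pk mul0r.
Qed.

Lemma is_max_point_gt0 p : (2 <= d)%N ->
  (forall k, nonzero_on_sphere (P k)) ->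
  is_max_point (abs_prod_pow P delta) (sphere R d) p ->
  0 < abs_prod_pow P delta p.
Proof.
move=> hd hP [_ pmax]; have [x sx Px] := sphere_point_nonzero_all hd hP.
apply: lt_le_trans (pmax x sx); apply: prodr_gt0 => k _.
by rewrite powR_gt0 // normr_gt0.
Qed.

(** On the great circle from q to p, the point q has parameter z = 1 and p has angle [ang_dist p q];
    the zero of P_k at q makes (z - 1)^(a_k) divide the restricted product. *)
Lemma prod_exprn_le_at_zero p q k (a : 'I_N -> nat) (S : R) : (2 <= d)%N ->
  sphere R d p -> sphere R d q -> peval (P k) q = 0 ->
  (forall x, sphere R d x -> \prod_j `|peval (P j) x| ^+ a j <= S) ->
  \prod_j `|peval (P j) p| ^+ a j <=
    (\sum_j a j * pdeg (P j)).*2.+1%:R * S *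
    ((\sum_j a j * pdeg (P j))%:R * ang_dist p q) ^+ a k / (a k)`!%:R.
Proof.
move=> hd sp sq Pkq PS; set D := (\sum_j a j * pdeg (P j))%N.
have pq1 := dotp_itv sp sq.
have [v [vv qv Dp]] := exists_great_circle hd sp sq.
have {}Dp : p = great_circle q v (cexp (ang_dist p q)).
  by rewrite /cexp /ang_dist acosK ?in_itv // sin_acos.
have /fin_all_exists2 [G szG PG] := fun j => great_circle_poly (P j) q v.
pose H := \prod_j G j ^+ a j.
have szH : (size H <= D.*2.+1)%N.
  have -> : D.*2 = (\sum_j (pdeg (P j)).*2 * a j)%N.
    rewrite -muln2 big_distrl; apply: eq_bigr => j _ /=.
    by rewrite muln2 doubleMr mulnC.
  by apply: size_prod_leS => j; exact: size_exp_leS.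
have PH z : `|z| = 1 -> conjc z ^+ D * H.[z] =
    ((\prod_j peval (P j) (great_circle q v z) ^+ a j)%:C)%C.
  move=> z1; rewrite expr_sum horner_prod -big_split rmorph_prod.
  apply: eq_bigr => j _ /=; rewrite rmorphXn /= PG // exprMn -exprM mulnC.
  by rewrite horner_exp.
have Gk1 : root (G k) 1.
  have := PG k 1 (normr1 _).
  rewrite conjc1 expr1n mul1r [great_circle _ _ _](_ : _ = q).
    by rewrite Pkq => /esym/eqP.
  by rewrite /great_circle /= scale1r scale0r addr0.
have -> : \prod_j `|peval (P j) p| ^+ a j =
    `|complex.Re (conjc (cexp (ang_dist p q)) ^+ D * H.[cexp (ang_dist p q)])|.
  rewrite PH ?norm_cexp // -Dp /= normr_prod.
  by apply: eq_bigr => j _; rewrite normrX.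
apply: norm_Re_circle_le => //.
- rewrite /H (bigD1 k) //= dvdp_mulr // dvdp_exp2r //.
  by rewrite dvdp_XsubCl.
- move=> z z1; have := congr1 Num.norm (PH z z1).
  have zJ : `|conjc z| = 1 by rewrite normcJ.
  rewrite normrM normrX zJ expr1n mul1r => ->.
  rewrite normc_def /= expr0n addr0 sqrtr_sqr lecR normr_prod.
  apply: le_trans (PS _ (great_circle_sphere sq vv qv z1)).
  by apply: ler_prod => j _; rewrite normrX exprn_ge0 /=.
- exact: acos_ge0.
Qed.

End MaximumPoint.

Lemma exists_nat_gt {R : realType} (x : R) : exists n : nat, x < n%:R.
Proof.
exists (Num.bound `|x|); apply: le_lt_trans (ler_norm x) _.
by apply: archi_boundP.
Qed.

Lemma exists_nat_ceil {R : realType} (x : R) : 0 < x ->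
  exists a : nat, x <= a%:R <= x + 1.
Proof.
move=> x0; exists `|Num.ceil x|%N; have /andP[] := ceil_itv x.
have -> : (`|Num.ceil x|%N)%:R = (Num.ceil x)%:~R :> R.
  rewrite -{2}(gez0_abs (_ : 0 <= Num.ceil x)) ?pmulrn //.
  by rewrite ceil_ge0 (lt_trans _ x0) ?ltrN10.
by rewrite intrB ltrBlDr => /ltW -> ->.
Qed.

(** * Distance from a maximum point to the zeros *)

Section MaximumFar.
Context {R : realType} {d N : nat}.
Context (P : 'I_N -> mvpoly R d) (delta : 'I_N -> R).
Context (delta0 : forall k, 0 < delta k).
Implicit Types (p q x : 'rV[R]_d).

(** Passing from the real exponents delta_j M to integers costs a factor independent of M;
    [prod_exprn_ge] is the matching lower bound. *)
Lemma prod_exprn_le x (B : 'I_N -> R) (M : nat) (a : 'I_N -> nat) :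
  (0 < M)%N -> (forall j, delta j * M%:R <= (a j)%:R <= delta j * M%:R + 1) ->
  (forall j, `|peval (P j) x| <= B j) ->
  \prod_j `|peval (P j) x| ^+ a j
    <= abs_prod_pow P delta x ^+ M * \prod_j Num.max 1 (B j).
Proof.
move=> M0 aM PB; rewrite -prodrXl -big_split /=; apply: ler_prod => j _.
rewrite exprn_ge0 //= -(powR_mulrn _ (powR_ge0 _ _)) -powRrM.
apply: le_trans (exprn_le_powR_max _ _ (aM j)) _ => //.
  by rewrite mulr_gt0 // ltr0n.
by rewrite ler_wpM2l ?powR_ge0 // le_max2 ?lexx.
Qed.

Lemma prod_exprn_ge x (M : nat) (a : 'I_N -> nat) :
  (0 < M)%N -> (forall j, delta j * M%:R <= (a j)%:R <= delta j * M%:R + 1) ->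
  abs_prod_pow P delta x ^+ M * \prod_j Num.min 1 `|peval (P j) x|
    <= \prod_j `|peval (P j) x| ^+ a j.
Proof.
move=> M0 aM; rewrite -prodrXl -big_split /=; apply: ler_prod => j _.
rewrite -(powR_mulrn _ (powR_ge0 _ _)) -powRrM; apply/andP; split.
  by rewrite mulr_ge0 ?powR_ge0 // le_min ler01 normr_ge0.
by apply: powR_min_le_exprn => //; rewrite mulr_gt0 // ltr0n.
Qed.

Lemma max_point_far_from_zero p k q : (2 <= d)%N ->
  (forall j, nonzero_on_sphere (P j)) ->
  \sum_(j < N) delta j * (pdeg (P j))%:R <= (expR 1)^-1 ->
  is_max_point (abs_prod_pow P delta) (sphere R d) p ->
  sphere R d q -> peval (P k) q = 0 -> delta k <= ang_dist p q.
Proof.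
move=> hd hP hsum pmax sq Pkq; rewrite leNgt; apply/negP => lt_pq.
have A0 := is_max_point_gt0 hd hP pmax; have [sp Amax] := pmax.
set A := abs_prod_pow P delta p in A0 Amax.
set t := ang_dist p q in lt_pq.
have t0 : 0 <= t by exact/acos_ge0/dotp_itv.
have /fin_all_exists [B PB] := fun j => peval_bounded_on_sphere (P j) (ltnW hd).
pose C1 := \prod_j Num.max 1 (B j); pose C2 := \prod_j Num.min 1 `|peval (P j) p|.
have C10 : 0 < C1 by apply: prodr_gt0 => j _; rewrite lt_max ltr01.
have C20 : 0 < C2.
  apply: prodr_gt0 => j _; rewrite lt_min ltr01 normr_gt0.
  apply: contraTneq A0 => Pj; rewrite /A /abs_prod_pow (bigD1 j) //= Pj normr0.
  by rewrite powR0 ?gt_eqF // mul0r ltxx.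
pose n := (\sum_j pdeg (P j))%N.
(* Half of the gap absorbs the error from rounding the exponents, and the other half is the rate of
   exponential decay. *)
pose c := (delta k - t) / 2.
have c0 : 0 < c by rewrite divr_gt0 // subr_gt0.
(* (2n + 3)M will bound 2D + 1, and C1 / C2 collects the rounding costs. *)
have [M0 hM0] := linear_expRN_lt1 ((2 * n%:R + 3) * C1 / C2) c0.
have [b tb] := exists_nat_gt (t * expR 1 * n%:R / c).
pose M := (M0 + b.+1)%N.
have M1 : (0 < M)%N by rewrite /M addnS.
have M0M : (M0 <= M)%N by exact: leq_addr.
have Mc : t * expR 1 * n%:R <= M%:R * c.
  rewrite -ler_pdivrMr //; apply: le_trans (ltW tb) _.
  by rewrite ler_nat; exact: leq_trans (leqnSn _) (leq_addl _ _).
have {tb}M1R : 1 <= M%:R :> R by rewrite ler1n.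
move: M M1 M0M Mc M1R => M M1 M0M Mc M1R {b}.
have /fin_all_exists [a aM] : forall j, exists a : nat,
    delta j * M%:R <= a%:R <= delta j * M%:R + 1.
  by move=> j; apply: exists_nat_ceil; rewrite mulr_gt0 // (lt_le_trans ltr01).
(* The hypothesis on the degrees enters here; rounding the exponents adds at most n, the sum of the
   degrees. *)
have D_le : (\sum_j a j * pdeg (P j))%:R <= M%:R * (expR 1)^-1 + n%:R :> R.
  apply: (@le_trans _ _ (\sum_j (delta j * M%:R + 1) * (pdeg (P j))%:R)).
    rewrite natr_sum; apply: ler_sum => j _; rewrite natrM ler_wpM2r //.
    by have /andP[] := aM j.
  under eq_bigr do rewrite mulrDl mul1r mulrAC.
  rewrite big_split /= -natr_sum lerD2r -mulr_suml mulrC.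
  by rewrite ler_wpM2l.
have key := @prod_exprn_le_at_zero R d N P p q k a (A ^+ M * C1) hd sp sq Pkq.
set D := (\sum_j a j * pdeg (P j))%N in D_le key.
have {}key : A ^+ M * C2 <=
    D.*2.+1%:R * (A ^+ M * C1) * (D%:R * t) ^+ a k / (a k)`!%:R.
  apply: le_trans (prod_exprn_ge p M1 aM) (key _) => x sx.
  apply: le_trans (prod_exprn_le M1 aM (fun j => PB j x sx)) _.
  rewrite ler_pM2r // lerXn2r ?nnegrE ?(ltW A0) ?Amax //.
  by apply: prodr_ge0 => j _; exact: powR_ge0.
have e0 := expR_gt0 (1 : R).
have dk0 := delta0 k.
have [ak1 _] := andP (aM k).
have term : (D%:R * t) ^+ a k / (a k)`!%:R <= expR (- (c * M%:R)).
  apply: (@le_trans _ _ (expR (- (c / delta k * (a k)%:R)))).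
    apply: taylor_term_le_expR; first by rewrite mulr_ge0.
    have s1 : 0 <= 1 - c / delta k.
      by rewrite subr_ge0 ler_pdivrMr // mul1r /c; lra.
    apply: (@le_trans _ _ ((1 - c / delta k) * (delta k * M%:R))); last first.
      by rewrite ler_wpM2l.
    (* By the choice of c, delta_k - c = t + c. *)
    have -> : (1 - c / delta k) * (delta k * M%:R) = M%:R * (t + c).
      by rewrite /c; field; exact: lt0r_neq0.
    apply: (@le_trans _ _ ((M%:R * (expR 1)^-1 + n%:R) * t * expR 1)).
      by rewrite ler_pM2r // ler_wpM2r.
    have -> : (M%:R * (expR 1)^-1 + n%:R) * t * expR 1 =
        M%:R * t + t * expR 1 * n%:R.
      by field; exact: lt0r_neq0.
    by rewrite mulrDr lerD2l.
  rewrite ler_expR lerN2 -mulrA ler_wpM2l ?(ltW c0) // mulrC ler_pdivlMr //.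
  by rewrite mulrC.
have D1 : D.*2.+1%:R <= (2 * n%:R + 3) * M%:R :> R.
  have e1 : (expR 1)^-1 <= 1 :> R.
    by rewrite invf_le1 // -[leLHS]expR0 ler_expR.
  have n0 : 0 <= n%:R :> R by [].
  rewrite -addn1 natrD -muln2 natrM.
  have : D%:R <= M%:R + n%:R :> R.
    by apply: le_trans D_le _; rewrite lerD2r ler_piMr.
  by nra.
have := hM0 M M0M; rewrite ltNge => /negP; apply.
have AM0 : 0 < A ^+ M by rewrite exprn_gt0.
(* The common factor A^M cancels, leaving a lower bound independent of M against an exponentially
   small upper bound. *)
have : C2 <= D.*2.+1%:R * C1 * expR (- (c * M%:R)).
  rewrite -(ler_pM2l AM0); apply: le_trans key _.
  rewrite [leRHS]mulrA [in leRHS]mulrCA -[leLHS]mulrA ler_wpM2l //.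
  by rewrite mulr_ge0 ?ler0n // mulr_ge0 // ltW.
move=> C2le.
have -> : (2 * n%:R + 3) * C1 / C2 * M%:R * expR (- (c * M%:R)) =
  (2 * n%:R + 3) * M%:R * C1 * expR (- (c * M%:R)) / C2.
  by field; exact: lt0r_neq0.
rewrite ler_pdivlMr // mul1r; apply: le_trans C2le _.
by rewrite ler_pM2r ?expR_gt0 // ler_pM2r.
Qed.

End MaximumFar.

(* On the two-point sphere d = 1 the claim fails: for x - 1 and x + 1 the
   product vanishes on the whole sphere. Hence 2 <= d. *)
Theorem theorem1p14 (R : realType) (d N : nat) (hd : (2 <= d)%N)
    (P : 'I_N -> mvpoly R d) (delta : 'I_N -> R)
    (hP : forall k, nonzero_on_sphere (P k))
    (hdelta : forall k, 0 < delta k)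
    (hsum : \sum_(k < N) delta k * (pdeg (P k))%:R <= (expR 1)^-1) :
  exists p : 'rV[R]_d,
    is_max_point (abs_prod_pow P delta) (sphere R d) p /\
    forall k : 'I_N,
      ((delta k)%:E <= ang_dist_set p (zero_set (P k) `&` sphere R d))%E.
Proof.
have [p pmax] :=
  exists_max_on_sphere (ltnW hd) (@continuous_abs_prod_pow _ _ _ P _ hdelta).
(* It suffices to bound the distance to each zero; if there are none, the infimum is +oo. *)
exists p; split=> // k; apply: le_ereal_inf_tmp => _ [q [Pkq sq] <-].
by rewrite lee_fin; exact: (max_point_far_from_zero hdelta hd hP hsum pmax).
Qed.
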